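(* For every $\eta\in(0,1)$, let $\mu_\eta$ be the Bernoulli measure on $\mathbb{R}$ with parameter $\eta$. Then there exists a dense set of functions $u\in L^2(\mathbb{R},\mu_\eta,\mathbb{C})$ with the following properties: 1. every point $z\in\mathbb{T}_u$ is wandering for the linear flow $\mathbf{\Phi}$; 2. no trajectory $\Gamma_z=\{\mathbf{\Phi}_tz: t\in\mathbb{R}\}$, $z\in\mathbb{T}_u$, is dense in $\mathbb{T}_u$.
   Context: For $\eta\in(0,1)$, the Bernoulli measure $\mu_\eta$ is the Borel probability measure on $\mathbb{R}$ that is the distribution of $\sum_{k=1}^\infty\varepsilon_k\eta^k$, where $\varepsilon_k$ are independent and take the values $\pm1$ with probability $1/2$ each. It is supported in $[-\frac{\eta}{1-\eta},\frac{\eta}{1-\eta}]$ and is characterized by $\int_{\mathbb{R}}e^{-2\pi itx}\,d\mu_\eta(x)=\prod_{k=1}^\infty\cos(2\pi t\eta^k)$, $t\in\mathbb{R}$. The linear flow on $H=L^2(\mathbb{R},\mu_\eta,\mathbb{C})$ is $(\mathbf{\Phi}_tv)(x)=e^{itx}v(x)$, $t\in\mathbb{R}$. For $u\in H$, the invariant torus is $\mathbb{T}_u=\{v\in H:|v(x)|=|u(x)|\text{ for }\mu_\eta\text{-a.e. }x\}$, with the topology induced from the norm of $H$. A point $z\in H$ is wandering for $\mathbf{\Phi}$ if there exist a neighborhood $O(z)\subset H$ of $z$ and a time $T>0$ such that $\mathbf{\Phi}_t(O(z))\cap O(z)=\emptyset$ for all $t>T$. *)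

(* Defs.v *)
From HB Require Import structures.
From mathcomp Require Import all_boot all_order all_algebra.
From mathcomp Require Import complex.
From mathcomp Require Import all_classical all_reals all_analysis.
From mathcomp Require Import measurable_realfun.

Set Implicit Arguments.
Unset Strict Implicit.
Unset Printing Implicit Defensive.

Import Order.TTheory GRing.Theory Num.Theory.
Import numFieldNormedType.Exports.

Local Open Scope classical_set_scope.
Local Open Scope ring_scope.

Local Notation normc := ComplexField.Normc.normc.

(* [A], a subset of [B], is dense in [B] for the subspace topology.           *)
Definition dense_in {X : topologicalType} (A B : set X) : Prop :=
  B `<=` closure A.

Section bernoulli_measure.
Context {R : realType}.

Definition mutually_independent d (T : measurableType d)
    (P : probability T R) (I : eqType) (X : I -> {RV P >-> R}) : Prop :=
  forall (J : seq I) (B : I -> set R), uniq J ->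
    (forall i, measurable (B i)) ->
    P (\bigcap_(i in [set` J]) (X i @^-1` B i)) =
    (\prod_(i <- J) P (X i @^-1` B i))%E.

(* The sequence [eps] is indexed from 0, hence the exponent [k.+1].  The       *)
(* predicate determines [mu] uniquely: [mu] is the law of the almost sure sum. *)
Definition is_bernoulli_measure (eta : R) (mu : probability R R) : Prop :=
  exists d (T : measurableType d) (P : probability T R)
    (eps : nat -> {RV P >-> R}) (S : {RV P >-> R}),
    [/\ mutually_independent eps,
        forall k, P (eps k @^-1` [set 1]) = 2^-1%:E /\
                  P (eps k @^-1` [set -1]) = 2^-1%:E,
        {ae P, forall w,
          series (fun k => eps k w * eta ^+ k.+1) n @[n --> \oo] --> S w} &
        forall A : set R, measurable A -> mu A = distribution P S A].

End bernoulli_measure.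

Section complex_L2.
Context d {T : measurableType d} {R : realType}.
Variable mu : {measure set T -> \bar R}.

Record L2fun := MkL2fun {
  L2fun_val :> T -> R[i];
  measurable_Re : measurable_fun [set: T] (fun x => complex.Re (L2fun_val x));
  measurable_Im : measurable_fun [set: T] (fun x => complex.Im (L2fun_val x));
  finite_L2norm : finite_norm mu 2%:E (fun x => normc (L2fun_val x)) }.

HB.instance Definition _ := gen_eqMixin L2fun.
HB.instance Definition _ := gen_choiceMixin L2fun.

Definition L2eq (f g : L2fun) : bool := `[< {ae mu, forall x, f x = g x} >].

Lemma L2eq_refl : reflexive L2eq.
Proof. by move=> f; apply/asboolP; apply: filterE. Qed.

Lemma L2eq_sym : symmetric L2eq.
Proof.
by move=> f g; apply/idP/idP => /asboolP h; apply/asboolP; apply: filterS h.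
Qed.

Lemma L2eq_trans : transitive L2eq.
Proof.
move=> f g h /asboolP gf /asboolP fh; apply/asboolP.
by apply: filterS2 gf fh => x -> ->.
Qed.

Canonical L2eq_equiv := EquivRel L2eq L2eq_refl L2eq_sym L2eq_trans.

Local Open Scope quotient_scope.

Definition L2 : Type := {eq_quot L2eq}.
HB.instance Definition _ := Choice.on L2.
HB.instance Definition _ := EqQuotient.on L2.

Definition L2_fun (u : L2) : T -> R[i] := L2fun_val (repr u).
Coercion L2_fun : L2 >-> Funclass.

Lemma L2_piE (f : L2fun) : {ae mu, forall x, (\pi_L2 f : L2) x = f x}.
Proof.
have /eqmodP/asboolP h : repr (\pi_L2 f) = f %[mod L2] by rewrite reprK.
exact: h.
Qed.

Lemma L2P (u v : L2) : u = v <-> {ae mu, forall x, u x = v x}.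
Proof.
split=> [->|h]; first exact: filterE.
rewrite -(reprK u) -(reprK v); apply/eqmodP/asboolP; exact: h.
Qed.

Lemma measurable_normcB (u v : L2) :
  measurable_fun [set: T] (fun x => normc (u x - v x)).
Proof.
have -> : (fun x => normc (u x - v x)) =
    (fun x => Num.sqrt ((complex.Re (u x) - complex.Re (v x)) ^+ 2 +
                        (complex.Im (u x) - complex.Im (v x)) ^+ 2)).
  by apply/funext => x; case: (u x) => a b; case: (v x).
apply: measurableT_comp; first exact: (continuous_measurable_fun (@sqrt_continuous R)).
apply: measurable_funD; apply/measurable_funX/measurable_funB;
  [exact: measurable_Re..|exact: measurable_Im|exact: measurable_Im].
Qed.

Lemma le_Lnorm2 (f g : T -> R) :
  measurable_fun [set: T] f -> measurable_fun [set: T] g ->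
  (forall x, 0 <= f x <= g x) ->
  ('N[mu]_(2%:E)[EFin \o f] <= 'N[mu]_(2%:E)[EFin \o g])%E.
Proof.
move=> mf mg fg; rewrite unlock /Lnorm.
have mp (h : T -> R) : measurable_fun [set: T] h ->
    measurable_fun [set: T] (fun x => `|(EFin \o h) x| `^ 2)%E.
  move=> mh; apply/measurable_EFinP.
  apply: (measurableT_comp (measurable_powR 2)).
  exact: measurableT_comp mh.
apply: gt0_ler_poweR.
- by rewrite invr_ge0 ler0n.
- by rewrite in_itv /= leey andbT integral_ge0// => x _; exact: poweR_ge0.
- by rewrite in_itv /= leey andbT integral_ge0// => x _; exact: poweR_ge0.
apply: ge0_le_integral => //.
- by move=> x _; exact: poweR_ge0.
- exact: mp.
- exact: mp.
move=> x _ /=; have /andP[f0 fgx] := fg x.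
rewrite lee_fin ge0_ler_powR ?nnegrE//.
by rewrite !ger0_norm// (le_trans f0).
Qed.

Lemma normc_ge0 (z : R[i]) : 0 <= normc z.
Proof. by case: z => a b; rewrite sqrtr_ge0. Qed.

Lemma Lnorm_normcD (f g h : T -> R[i]) :
  measurable_fun [set: T] (fun x => normc (f x)) ->
  measurable_fun [set: T] (fun x => normc (g x)) ->
  measurable_fun [set: T] (fun x => normc (h x)) ->
  (forall x, h x = f x + g x) ->
  (Lnorm mu 2%:E (fun x => (normc (h x))%:E) <=
   Lnorm mu 2%:E (fun x => (normc (f x))%:E) +
   Lnorm mu 2%:E (fun x => (normc (g x))%:E))%E.
Proof.
move=> mf mg mh hfg.
apply: le_trans (eminkowski mu mf mg _); last by rewrite lee_fin ler1n.
apply: le_Lnorm2 => //; first exact: measurable_funD.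
by move=> x; rewrite normc_ge0 hfg le_normcD.
Qed.

Lemma measurable_normc (u : L2) : measurable_fun [set: T] (fun x => normc (u x)).
Proof.
have -> : (fun x => normc (u x)) =
    (fun x => Num.sqrt (complex.Re (u x) ^+ 2 + complex.Im (u x) ^+ 2)).
  by apply/funext => x; case: (u x).
apply: measurableT_comp; first exact: (continuous_measurable_fun (@sqrt_continuous R)).
apply: measurable_funD; apply/measurable_funX;
  [exact: measurable_Re|exact: measurable_Im].
Qed.

Definition L2dist (u v : L2) : R :=
  fine (Lnorm mu 2%:E (fun x => (normc (u x - v x))%:E)).

Lemma L2dist_EFin (u v : L2) :
  (L2dist u v)%:E = Lnorm mu 2%:E (fun x => (normc (u x - v x))%:E).
Proof.
rewrite fineK// ge0_fin_numE ?Lnorm_ge0//.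
apply: (@le_lt_trans _ _ (Lnorm mu 2%:E (fun x => (normc (u x))%:E) +
  Lnorm mu 2%:E (fun x => (normc (- v x))%:E))%E).
  apply: Lnorm_normcD => //; first exact: measurable_normc.
    by under eq_fun do rewrite normcN; exact: measurable_normc.
  exact: measurable_normcB.
under [X in (_ + X)%E]eq_Lnorm do rewrite normcN.
by rewrite lte_add_pinfty//; exact: finite_L2norm.
Qed.

Lemma L2distxx (u : L2) : L2dist u u = 0.
Proof.
apply: EFin_inj; rewrite L2dist_EFin.
rewrite -[RHS](@Lnorm0 _ T _ mu 2%:E); last by rewrite eqe pnatr_eq0.
by apply: eq_Lnorm => x; rewrite subrr ComplexField.Normc.normc0.
Qed.

Lemma L2dist_eq0 (u v : L2) : L2dist u v = 0 -> u = v.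
Proof.
move=> uv; apply/L2P.
have uv0 : Lnorm mu 2%:E (fun x => (normc (u x - v x))%:E) = 0%E.
  by rewrite -L2dist_EFin uv.
have muv : measurable_fun [set: T] (fun x => (normc (u x - v x))%:E).
  by apply/measurable_EFinP; exact: measurable_normcB.
have lt02 : (0 < 2%:E :> \bar R)%E by rewrite lte_fin.
have := Lnorm_eq0_eq0 muv lt02 uv0.
apply: filterS => x /(_ I)/= [/ComplexField.Normc.eq0_normc/eqP].
by rewrite subr_eq0 => /eqP.
Qed.

Lemma L2dist_sym (u v : L2) : L2dist u v = L2dist v u.
Proof. by congr fine; apply: eq_Lnorm => x; rewrite -opprB normcN. Qed.

Lemma L2dist_triangle (v u w : L2) : L2dist u w <= L2dist u v + L2dist v w.
Proof.
rewrite -lee_fin EFinD !L2dist_EFin.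
by apply: Lnorm_normcD => [|||x]; [exact: measurable_normcB..|rewrite subrKA].
Qed.

HB.instance Definition _ :=
  isMetric.Build R L2 L2distxx L2dist_eq0 L2dist_sym L2dist_triangle.

End complex_L2.

Arguments L2 {d T R} mu.
Arguments L2fun {d T R} mu.

Section linear_flow.
Context {R : realType}.
Variable mu : probability R R.
Local Open Scope quotient_scope.

Definition phase (t x : R) : R[i] := Complex (cos (t * x)) (sin (t * x)).

Section phase_mul.
Variables (t : R) (f : L2fun mu).
Let g (x : R) : R[i] := phase t x * f x.

Let mcos : measurable_fun [set: R] (fun x => cos (t * x)).
Proof.
apply: (measurableT_comp (f := cos)).
  exact: (continuous_measurable_fun (@continuous_cos R)).
exact: mulrl_measurable.
Qed.

Let msin : measurable_fun [set: R] (fun x => sin (t * x)).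
Proof.
apply: (measurableT_comp (f := sin)).
  exact: (continuous_measurable_fun (@continuous_sin R)).
exact: mulrl_measurable.
Qed.

Lemma measurable_Re_phase_mul :
  measurable_fun [set: R] (fun x => complex.Re (g x)).
Proof.
have -> : (fun x => complex.Re (g x)) = (fun x =>
    cos (t * x) * complex.Re (f x) - sin (t * x) * complex.Im (f x)).
  by apply/funext => x; rewrite /g; case: (L2fun_val f x).
by apply: measurable_funB; apply: measurable_funM => //;
  [exact: measurable_Re|exact: measurable_Im].
Qed.

Lemma measurable_Im_phase_mul :
  measurable_fun [set: R] (fun x => complex.Im (g x)).
Proof.
have -> : (fun x => complex.Im (g x)) = (fun x =>
    cos (t * x) * complex.Im (f x) + sin (t * x) * complex.Re (f x)).
  by apply/funext => x; rewrite /g; case: (L2fun_val f x).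
by apply: measurable_funD; apply: measurable_funM => //;
  [exact: measurable_Im|exact: measurable_Re].
Qed.

Lemma finite_L2norm_phase_mul : finite_norm mu 2%:E (fun x => normc (g x)).
Proof.
have -> : (fun x => normc (g x)) = (fun x => normc (f x)).
  apply/funext => x; rewrite /g ComplexField.Normc.normcM.
  by rewrite /phase/= cos2Dsin2 sqrtr1 mul1r.
exact: finite_L2norm.
Qed.

Definition phase_mul : L2fun mu := MkL2fun measurable_Re_phase_mul
  measurable_Im_phase_mul finite_L2norm_phase_mul.

End phase_mul.

Definition linear_flow (t : R) (v : L2 mu) : L2 mu :=
  \pi_(L2 mu) (phase_mul t (repr v)).

Lemma linear_flowE (t : R) (v : L2 mu) :
  {ae mu, forall x, linear_flow t v x = phase t x * v x}.
Proof. exact: L2_piE. Qed.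

Definition invariant_torus (u : L2 mu) : set (L2 mu) :=
  [set v | {ae mu, forall x, `|v x| = `|u x|}].

Lemma invariant_torus_flow (u z : L2 mu) (t : R) :
  invariant_torus u z -> invariant_torus u (linear_flow t z).
Proof.
rewrite /invariant_torus/= => uz.
apply: filterS2 uz (linear_flowE t z) => x <- ->.
by rewrite normrM normc_def /phase/= cos2Dsin2 sqrtr1 mul1r.
Qed.

Definition trajectory (z : L2 mu) : set (L2 mu) :=
  range (fun t => linear_flow t z).

Lemma trajectory_sub_torus (u z : L2 mu) :
  invariant_torus u z -> trajectory z `<=` invariant_torus u.
Proof. by move=> uz _ [t _ <-]; exact: invariant_torus_flow. Qed.

Definition wandering (z : L2 mu) : Prop :=
  exists O : set (L2 mu), nbhs z O /\
    exists T : R, 0 < T /\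
      forall t, T < t -> (linear_flow t @` O) `&` O = set0.

End linear_flow.

(* Main.v *)
Require Import Defs.
From mathcomp Require Import all_boot all_order all_algebra.
From mathcomp Require Import complex.
From mathcomp Require Import all_classical all_reals all_analysis.
From mathcomp Require Import measurable_realfun ring lra.

Import Order.TTheory GRing.Theory Num.Theory.
Import numFieldNormedType.Exports.

Local Open Scope classical_set_scope.
Local Open Scope ring_scope.
Set Implicit Arguments.
Unset Strict Implicit.
Unset Printing Implicit Defensive.

(** Write phi(t) for the integral of cos(t x) against mu, that is, the real
    part of the Fourier transform of mu, and [kappa = cos (eta * (pi / 2))],
    so that 0 <= kappa < 1.  The proof rests on two bounds:
      - phi(t) <= kappa as soon as |t| eta > pi / 2;
      - phi(t) >= - kappa for every t.
    Both come from the product formula phi(t) = prod_k cos(t eta^k)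
    ([bernoulli_cos_cvg]).  The numbers |t| eta^k decrease to 0 by the factor
    eta, so, if |t| eta > pi / 2, one of them falls between eta * (pi / 2) and
    pi / 2; the corresponding cosine is at most kappa, and the other factors
    are at most 1 in absolute value ([bernoulli_cos_abs]).  If
    |t| eta <= pi / 2, all the cosines are nonnegative, hence so is phi(t)
    ([bernoulli_cos_ge]).  Unlike the decay of phi at infinity, which fails
    when eta is the inverse of a Pisot number other than 2, this works for
    every eta.

    The dense set consists of the u whose modulus is bounded below by some
    constant c > 0; it is dense because raising |u| to e where it is smaller
    than e moves u by at most 2 e.  Membership only depends on |u|, hence is
    shared by all the points z of the torus of u.  For such a z and for
    s = 1 or s = -1,
      dist(Phi_t z, s z)^2 = int |e^(i t x) - s|^2 |z|^2 dmu
                          >= 2 c^2 (1 - s phi(t))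
    ([L2dist_phase_ge]).  With s = 1, the first bound on phi keeps Phi_t z at
    a fixed distance from z for t large, so that z is wandering because Phi_t
    is nonexpansive.  With s = -1, the second bound keeps the whole trajectory
    of z at a fixed distance from -z, a point of the torus. *)

(** * Independent fair signs *)

Section random_signs.
Context d (T : measurableType d) (R : realType) (P : probability T R).
Variable eps : nat -> {RV P >-> R}.
Hypothesis eps_indep : mutually_independent eps.
Hypothesis eps_fair : forall k, P (eps k @^-1` [set 1]) = 2^-1%:E /\
                                P (eps k @^-1` [set -1]) = 2^-1%:E.

Definition cylinder (s : seq R) : set T :=
  [set w | forall i, (i < size s)%N -> eps i w = s`_i].

Definition signs (s : seq R) : bool := all (fun e => (e == 1) || (e == -1)) s.

Lemma cylinder_bigcap (s : seq R) : cylinder s =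
  \bigcap_(i in [set` index_iota 0 (size s)]) (eps i @^-1` [set s`_i]).
Proof.
apply/seteqP; split=> w sw i /=.
  by rewrite mem_index_iota => /sw.
by move=> i_lt; apply: sw; rewrite /= mem_index_iota.
Qed.

Lemma measurable_cylinder (s : seq R) : measurable (cylinder s).
Proof.
rewrite cylinder_bigcap; apply: bigcap_measurableType => i _.
exact: measurable_funPTI.
Qed.

Lemma probability_cylinder (s : seq R) : signs s ->
  P (cylinder s) = (2^-1 ^+ size s)%:E.
Proof.
move=> /allP ss; rewrite cylinder_bigcap eps_indep ?iota_uniq//.
rewrite (_ : 2^-1 ^+ size s = \prod_(0 <= i < size s) (2^-1 : R)); last first.
  by rewrite prodr_const_nat subn0.
rewrite -prodEFin; apply: eq_big_seq => i.
rewrite mem_index_iota /= => i_lt.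
by have /orP[/eqP->|/eqP->] := ss _ (mem_nth 0 i_lt); have [] := eps_fair i.
Qed.

Lemma cylinder_rcons (s : seq R) (e : R) :
  cylinder (rcons s e) = cylinder s `&` eps (size s) @^-1` [set e].
Proof.
apply/seteqP; split=> [w sw|w [sw se] i].
  split=> [i i_lt|].
    by rewrite sw ?size_rcons ?(ltnW (m:=i.+1))// nth_rcons i_lt.
  by rewrite /= sw ?size_rcons// nth_rcons ltnn eqxx.
rewrite size_rcons ltnS leq_eqVlt nth_rcons => /predU1P[->|i_lt].
  by rewrite ltnn eqxx.
by rewrite i_lt; exact: sw.
Qed.

Lemma sign_negligible (k : nat) :
  P (~` (eps k @^-1` [set 1] `|` eps k @^-1` [set -1])) = 0%E.
Proof.
have m1 : measurable (eps k @^-1` [set 1]) by exact: measurable_funPTI.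
have mN1 : measurable (eps k @^-1` [set -1]) by exact: measurable_funPTI.
rewrite probability_setC; last exact: measurableU.
rewrite measureU//; last first.
  by apply/seteqP; split=> // w [/= -> eqN1]; have : False by lra.
have [P1 PN1] := eps_fair k.
transitivity (1%:E - (2^-1%:E + 2^-1%:E) : \bar R)%E.
  by congr (_ - (_ + _))%E.
by rewrite -!EFinD; congr EFin; lra.
Qed.

Variable a : nat -> R.

Definition weighted_sum (n : nat) (w : T) : R :=
  \sum_(0 <= i < n) a i * eps i w.

Lemma measurable_cos_weighted_sum (n : nat) :
  measurable_fun [set: T] (fun w => cos (weighted_sum n w)).
Proof.
apply: (measurableT_comp (f := cos)).
  exact: (continuous_measurable_fun (@continuous_cos R)).
by apply: measurable_sum => i; exact: measurable_funM.
Qed.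

(** The cosine of a weighted sum of independent signs is integrated one sign at
    a time, from the last to the first: fixing the next sign to 1 or -1 splits
    the cylinder into two halves of equal mass, and
    cos (x + y) + cos (x - y) = 2 cos x cos y extracts a factor.  Working with
    cylinders makes the independence of events enough, without product
    measures. *)
Lemma integral_cos_cylinder (j : nat) (s : seq R) : signs s ->
  (\int[P]_(w in cylinder s) (cos (weighted_sum (size s + j) w))%:E =
   (2^-1 ^+ size s * cos (\sum_(0 <= i < size s) a i * s`_i) *
     \prod_(size s <= i < size s + j) cos (a i))%:E)%E.
Proof.
have neq1N1 : (1 : R) <> -1 by lra.
elim: j s => [|j IHj] s ss.
  rewrite addn0 [X in _ * X]big_geq// mulr1.
  rewrite (eq_integral (cst (cos (\sum_(0 <= i < size s) a i * s`_i))%:E)).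
    rewrite integral_cst; last exact: measurable_cylinder.
    by rewrite [X in (_ * X)%E](probability_cylinder ss) -EFinM mulrC.
  move=> w; rewrite inE => sw; congr ((cos _)%:E).
  by apply: eq_big_nat => i /= i_lt; rewrite sw.
set m := size s; set f := fun w => (cos (weighted_sum (m + j.+1) w))%:E.
have mf D : measurable_fun D f.
  apply/measurable_EFinP/measurable_funTS.
  exact: measurable_cos_weighted_sum.
(* The signs take the values 1 and -1 only almost surely, whence this null
   part of the cylinder. *)
set N := cylinder s `&` ~` (eps m @^-1` [set 1] `|` eps m @^-1` [set -1]).
have m1 : measurable (eps m @^-1` [set 1]) by exact: measurable_funPTI.
have mN1 : measurable (eps m @^-1` [set -1]) by exact: measurable_funPTI.
have mN : measurable N.
  apply: measurableI; first exact: measurable_cylinder.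
  exact/measurableC/measurableU.
have PN : P N = 0%E.
  apply: (@subset_measure0 _ _ _ _ _ _ _ _ (@subIsetr _ _ _)) => //.
    exact/measurableC/measurableU.
  exact: sign_negligible.
have split_s : cylinder s =
    (cylinder (rcons s 1) `|` cylinder (rcons s (-1))) `|` N.
  by rewrite !cylinder_rcons -!setIUr setUv setIT.
have branch e : (e == 1) || (e == -1) ->
    (\int[P]_(w in cylinder (rcons s e)) f w =
    (2^-1 ^+ m.+1 * cos (\sum_(0 <= i < m) a i * s`_i + a m * e) *
     \prod_(m.+1 <= i < m.+1 + j) cos (a i))%:E)%E.
  move=> he; have := IHj (rcons s e).
  rewrite /signs all_rcons he /= => /(_ ss); rewrite size_rcons.
  rewrite /f addnS -addSn => ->; congr ((_ * cos _ * _)%:E).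
  rewrite big_nat_recr//= nth_rcons ltnn eqxx; congr (_ + _).
  by apply: eq_big_nat => i /= i_lt; rewrite nth_rcons i_lt.
rewrite split_s integral_setU//; last 2 first.
- by apply: measurableU; exact: measurable_cylinder.
- apply/disj_setPS => w [+ [_ /=]].
  by rewrite !cylinder_rcons => -[[_ ?]|[_ ?]]; case; [left|right].
rewrite integral_setU//; [|exact: measurable_cylinder..|]; last first.
  apply/disj_setPS => w []; rewrite !cylinder_rcons => -[_ /= ->] [_ /= eqN1].
  exact: neq1N1.
rewrite (null_set_integral mN)// adde0 !branch ?eqxx ?orbT// -EFinD; congr EFin.
rewrite addnS -addSn [in RHS]big_ltn ?leq_addr//.
by rewrite mulr1 mulrN1 cosB cosD exprS; field.
Qed.

Lemma expectation_cos_weighted_sum (n : nat) :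
  (\int[P]_w (cos (weighted_sum n w))%:E =
   (\prod_(0 <= i < n) cos (a i))%:E)%E.
Proof.
have := @integral_cos_cylinder n [::] isT.
rewrite (_ : cylinder [::] = setT); last by apply/seteqP; split.
by rewrite /= add0n expr0 big_geq// cos0 !mul1r.
Qed.

End random_signs.

(** * Cosine transform of the Bernoulli measure *)

Section bernoulli_transform.
Context (R : realType).

Lemma measurable_cosM (t : R) : measurable_fun [set: R] (fun x => cos (t * x)).
Proof.
apply: (measurableT_comp (f := cos)).
  exact: (continuous_measurable_fun (@continuous_cos R)).
exact: mulrl_measurable.
Qed.

Lemma integrable_cos (mu : probability R R) (t : R) :
  mu.-integrable [set: R] (EFin \o (fun x => cos (t * x))).
Proof.
apply: (le_integrable measurableT)
  (finite_measure_integrable_cst mu 1 measurableT).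
- by apply/measurable_EFinP; exact: measurable_cosM.
- by move=> x _ /=; rewrite lee_fin normr1 cos_max.
Qed.

(** The partial sums of the random series converge almost surely, and the
    cosine is bounded, so the finite product formula passes to the limit by
    dominated convergence. *)
Lemma bernoulli_cos_cvg (eta : R) (mu : probability R R) (t : R) :
  is_bernoulli_measure eta mu ->
  \prod_(0 <= i < n) cos (t * eta ^+ i.+1) @[n --> \oo] -->
    \int[mu]_x cos (t * x).
Proof.
move=> [d [T [P [eps [S [eps_indep eps_fair series_cvg muS]]]]]].
pose a i := t * eta ^+ i.+1.
have weighted_sumE n w : weighted_sum eps a n w =
    t * series (fun k => eps k w * eta ^+ k.+1) n.
  rewrite /weighted_sum seriesEnat /= big_distrr; apply: eq_bigr => i _.
  by rewrite /a /= -mulrA (mulrC (eps i w)).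
have : (\int[P]_w (cos (weighted_sum eps a n w))%:E)%E @[n --> \oo] -->
    (\int[P]_w (cos (t * S w))%:E)%E.
  have [] // := @dominated_convergence _ _ _ P setT measurableT
    (fun n w => (cos (weighted_sum eps a n w))%:E)
    (fun w => (cos (t * S w))%:E) (cst 1%:E).
  - by move=> n; apply/measurable_EFinP; exact: measurable_cos_weighted_sum.
  - by apply/measurable_EFinP/(measurableT_comp (measurable_cosM t)).
  - apply: filterS series_cvg => w Sw _; apply: cvg_EFin; first exact: nearW.
    apply: continuous_cvg; first exact: continuous_cos.
    under eq_fun do rewrite weighted_sumE.
    exact: cvgZr.
  - exact: finite_measure_integrable_cst.
  - by apply: nearW => w n _; rewrite /= lee_fin cos_max.
under eq_fun do rewrite expectation_cos_weighted_sum//.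
move=> cvg_int.
have int_cosS : P.-integrable setT (fun w => (cos (t * S w))%:E).
  apply: (le_integrable measurableT)
    (finite_measure_integrable_cst P 1 measurableT).
    by apply/measurable_EFinP/(measurableT_comp (measurable_cosM t)).
  by move=> w _ /=; rewrite lee_fin normr1 cos_max.
have -> : \int[mu]_x cos (t * x) = fine (\int[P]_w (cos (t * S w))%:E)%E.
  congr fine.
  rewrite (@eq_measure_integral _ _ _ _ (distribution P S)); last first.
    by move=> A mA _; exact: muS.
  rewrite integral_distribution//.
  by apply/measurable_EFinP; exact: measurable_cosM.
apply: (fine_cvg (f := fun n => (\prod_(0 <= i < n) cos (a i))%:E)).
by rewrite fineK//; exact: integrable_fin_num.
Qed.

Variables (eta : R) (mu : probability R R).
Hypotheses (eta_gt0 : 0 < eta) (eta_lt1 : eta < 1).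
Hypothesis mu_eta : is_bernoulli_measure eta mu.

Lemma scaled_pihalf_bounds : 0 < eta * (pi / 2) < pi / 2.
Proof.
have pihalf_gt0 : 0 < pi / 2 :> R by rewrite divr_gt0 ?pi_gt0.
by rewrite mulr_gt0//= gtr_pMl.
Qed.

Lemma cos_scale_lt1 : 0 <= cos (eta * (pi / 2)) < 1.
Proof.
have pi0 := @pi_gt0 R; have /andP[ep0 ep1] := scaled_pihalf_bounds.
apply/andP; split.
  by apply: cos_ge0_pihalf; apply/andP; split; lra.
rewrite -[ltRHS]cos0 ltr_cos ?in_itv /= ?lexx ?pi_ge0//.
by apply/andP; split; lra.
Qed.

(** The first k such that |t| eta^(k+1) <= pi / 2 also satisfies
    |t| eta^(k+1) >= eta * (pi / 2), because |t| eta^k > pi / 2; a single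
    factor of the product thus provides the bound. *)
Lemma bernoulli_cos_abs (t : R) : pi / 2 < `|t| * eta ->
  `|\int[mu]_x cos (t * x)| <= cos (eta * (pi / 2)).
Proof.
move=> t_big.
have pi0 := @pi_gt0 R; have /andP[ep0 ep1] := scaled_pihalf_bounds.
have [k eta_pi_k k_pi] : exists2 k, eta * (pi / 2) <= `|t| * eta ^+ k.+1 &
    `|t| * eta ^+ k.+1 <= pi / 2.
  have small : exists k, `|t| * eta ^+ k.+1 <= pi / 2.
    have : `|t| * eta ^+ n.+1 @[n --> \oo] --> (`|t| * 0 : R).
      apply: cvgZr; have := @cvg_expr R eta.
      rewrite -(cvg_shiftS (GRing.exp eta)); apply.
      by rewrite gtr0_norm.
    rewrite mulr0 => /cvgrPdist_le /(_ (pi / 2)) [|N _ /(_ N (leqnn N))].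
      by lra.
    rewrite /= sub0r normrN => hN; exists N.
    exact: le_trans (ler_norm _) hN.
  have [k hk kmin] := ex_minnP small; exists k => //.
  case: k hk kmin => [|k _ kmin]; first by rewrite expr1 leNgt t_big.
  have : pi / 2 < `|t| * eta ^+ k.+1.
    by rewrite ltNge; apply/negP => /kmin; rewrite ltnn.
  by rewrite [in leRHS]exprS; nra.
have cos_k : `|cos (t * eta ^+ k.+1)| <= cos (eta * (pi / 2)).
  rewrite -cos_norm normrM (ger0_norm (exprn_ge0 _ (ltW eta_gt0))).
  rewrite (ger0_norm (cos_ge0_pihalf _)); last by apply/andP; split; lra.
  by rewrite leNgt ltr_cos ?in_itv /= -?leNgt//; apply/andP; split; lra.
apply: cvgr_to_le (cvg_norm (bernoulli_cos_cvg (t := t) mu_eta)) _.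
exists k.+1 => // n /= k_lt_n.
rewrite normr_prod (bigD1_seq k) ?mem_index_iota ?iota_uniq//=.
rewrite -[leRHS]mulr1 ler_pM// ?prodr_ge0//.
apply: Num.Theory.prodr_ile1 => i _.
by rewrite normr_ge0 cos_max.
Qed.

(** Only large t is a concern: for small t all the factors of the product are
    nonnegative. *)
Lemma bernoulli_cos_ge (t : R) :
  - cos (eta * (pi / 2)) <= \int[mu]_x cos (t * x).
Proof.
have [/bernoulli_cos_abs|t_small] := ltP (pi / 2) (`|t| * eta).
  by rewrite ler_norml => /andP[].
have /andP[kappa_ge0 _] := cos_scale_lt1.
apply: (@le_trans _ _ 0); first by rewrite oppr_le0.
apply: cvgr_to_ge (bernoulli_cos_cvg (t := t) mu_eta) _; apply: nearW => n.
apply: prodr_ge0 => i _.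
rewrite -cos_norm normrM (ger0_norm (exprn_ge0 _ (ltW eta_gt0))).
apply: cos_ge0_pihalf.
have -> /= : `|t| * eta ^+ i.+1 <= pi / 2.
  apply: le_trans t_small; rewrite ler_wpM2l// exprS.
  by rewrite ler_piMr ?exprn_ile1 ?(ltW eta_gt0) ?(ltW eta_lt1).
rewrite andbT (@le_trans _ _ 0)//; first by have := @pi_gt0 R; lra.
by rewrite mulr_ge0// exprn_ge0 ?ltW.
Qed.

End bernoulli_transform.

(** * Distances in L2 *)

Section L2_facts.
Context (R : realType) (mu : probability R R).
Local Notation normc := ComplexField.Normc.normc.
Local Open Scope quotient_scope.

Lemma sqr_normc (z : R[i]) :
  normc z ^+ 2 = complex.Re z ^+ 2 + complex.Im z ^+ 2.
Proof. by case: z => a b; rewrite /= sqr_sqrtr// addr_ge0 ?sqr_ge0. Qed.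

Lemma eq_norm_normc (z w : R[i]) : `|z| = `|w| -> normc z = normc w.
Proof. by case: z => a b; case: w => c e; rewrite !normc_def => -[]. Qed.

Lemma L2dist_ge0 (u v : L2 mu) : 0 <= L2dist u v.
Proof. by rewrite fine_ge0// Lnorm_ge0. Qed.

Lemma L2dist_sqr (u v : L2 mu) :
  (L2dist u v ^+ 2)%:E = (\int[mu]_x (normc (u x - v x) ^+ 2)%:E)%E.
Proof.
have := @poweR_Lnorm _ _ _ mu (fun x => (normc (u x - v x))%:E) 2.
rewrite -L2dist_EFin poweR_EFin powR_mulrn ?L2dist_ge0// => -> //.
by apply: eq_integral => x _; rewrite /= powR_mulrn// real_normK ?num_real.
Qed.

Lemma measurable_sqr_normcB (u v : L2 mu) :
  measurable_fun [set: R] (fun x => (normc (u x - v x) ^+ 2)%:E).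
Proof. by apply/measurable_EFinP/measurable_funX; exact: measurable_normcB. Qed.

Lemma ler_L2dist (u v u' v' : L2 mu) :
  {ae mu, forall x, normc (u x - v x) <= normc (u' x - v' x)} ->
  L2dist u v <= L2dist u' v'.
Proof.
move=> le_uv; rewrite -ler_sqr ?nnegrE ?L2dist_ge0// -lee_fin !L2dist_sqr.
apply: ae_ge0_le_integral => //.
- by move=> x _; rewrite lee_fin sqr_ge0.
- exact: measurable_sqr_normcB.
- by move=> x _; rewrite lee_fin sqr_ge0.
- exact: measurable_sqr_normcB.
apply: filterS le_uv => x + _.
by rewrite lee_fin ler_sqr ?nnegrE ?normc_ge0.
Qed.

Lemma L2dist_le_cst (u v : L2 mu) (e : R) : 0 <= e ->
  {ae mu, forall x, normc (u x - v x) <= e} -> L2dist u v <= e.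
Proof.
move=> e_ge0 le_uv; rewrite -ler_sqr ?nnegrE ?L2dist_ge0// -lee_fin L2dist_sqr.
rewrite -[leRHS]mule1 -(@probability_setT _ _ _ mu) -integral_cst//.
apply: ae_ge0_le_integral => //.
- by move=> x _; rewrite lee_fin sqr_ge0.
- exact: measurable_sqr_normcB.
- by move=> x _; rewrite lee_fin sqr_ge0.
apply: filterS le_uv => x + _.
by rewrite lee_fin ler_sqr ?nnegrE ?normc_ge0.
Qed.

Lemma normc_phase (t x : R) : normc (phase t x) = 1.
Proof. by rewrite /phase /= cos2Dsin2 sqrtr1. Qed.

Lemma linear_flow_contract (t : R) (u v : L2 mu) :
  L2dist (linear_flow t u) (linear_flow t v) <= L2dist u v.
Proof.
apply: ler_L2dist; apply: filterS2 (linear_flowE t u) (linear_flowE t v).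
by move=> x -> ->; rewrite -mulrBr ComplexField.Normc.normcM normc_phase mul1r.
Qed.

(** Builds the two perturbations of u used below: its opposite, with e = 0, and
    its truncation away from 0. *)
Lemma L2_of_bounded (f : R -> R[i]) (u : L2 mu) (e : R) : 0 <= e ->
  measurable_fun [set: R] (fun x => complex.Re (f x)) ->
  measurable_fun [set: R] (fun x => complex.Im (f x)) ->
  (forall x, normc (f x) <= normc (u x) + e) ->
  exists v : L2 mu, {ae mu, forall x, v x = f x}.
Proof.
move=> e_ge0 mRe mIm le_f.
have mf : measurable_fun [set: R] (fun x => normc (f x)).
  rewrite (_ : (fun x => _) = (fun x =>
      Num.sqrt (complex.Re (f x) ^+ 2 + complex.Im (f x) ^+ 2))); last first.
    by apply/funext => x; case: (f x).
  apply: measurableT_comp.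
    exact: (continuous_measurable_fun (@sqrt_continuous R)).
  by apply: measurable_funD; exact: measurable_funX.
have fin_f : finite_norm mu 2%:E (fun x => normc (f x)).
  rewrite /finite_norm.
  refine (@le_lt_trans _ _
    (Lnorm mu 2%:E (EFin \o (fun x => normc (u x) + e))) _ _ _ _).
    apply: le_Lnorm2 => //.
      by apply: measurable_funD => //; exact: measurable_normc.
    by move=> x; rewrite normc_ge0 le_f.
  apply: le_lt_trans
    (eminkowski mu (measurable_normc u) (measurable_cst e) _) _.
    by rewrite lee_fin ler1n.
  rewrite lte_add_pinfty//; first exact: finite_L2norm.
  rewrite unlock /Lnorm poweR_lty//=.
  rewrite (_ : (fun x => _) = cst ((`|e| `^ 2)%:E))//.
  by rewrite integral_cst// [X in (_ * X)%E]probability_setT mule1 ltry.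
exists (\pi_(L2 mu) (MkL2fun mRe mIm fin_f)); exact: L2_piE.
Qed.

Lemma exists_L2_opp (z : L2 mu) :
  exists v : L2 mu, {ae mu, forall x, v x = - z x}.
Proof.
apply: (@L2_of_bounded _ z 0) => //.
- have -> : (fun x => complex.Re (- z x)) = (fun x => - complex.Re (z x)).
    by apply/funext => x; case: (z x).
  by apply: measurable_funN; exact: measurable_Re.
- have -> : (fun x => complex.Im (- z x)) = (fun x => - complex.Im (z x)).
    by apply/funext => x; case: (z x).
  by apply: measurable_funN; exact: measurable_Im.
- by move=> x; rewrite normcN addr0.
Qed.

Lemma exists_L2_bounded_away (u : L2 mu) (e : R) : 0 < e ->
  exists v : L2 mu, {ae mu, forall x, e <= normc (v x)} /\ L2dist u v <= e + e.
Proof.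
move=> e_gt0; pose f x := if normc (u x) < e then e%:C%C else u x.
have normc_e : normc e%:C%C = e.
  by rewrite /= expr0n addr0 sqrtr_sqr ger0_norm// ltW.
have mlt : measurable_fun [set: R] (fun x => normc (u x) < e).
  by apply: measurable_fun_ltr => //; exact: measurable_normc.
have [] := @L2_of_bounded f u e (ltW e_gt0).
- have -> : (fun x => complex.Re (f x)) =
      (fun x => if normc (u x) < e then e else complex.Re (u x)).
    by apply/funext => x; rewrite /f; case: ifP.
  by apply: measurable_fun_ifT => //; exact: measurable_Re.
- have -> : (fun x => complex.Im (f x)) =
      (fun x => if normc (u x) < e then 0 else complex.Im (u x)).
    by apply/funext => x; rewrite /f; case: ifP.
  by apply: measurable_fun_ifT => //; exact: measurable_Im.
- move=> x; rewrite /f; case: ifP => _; last by rewrite lerDl ltW.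
  by rewrite normc_e lerDr normc_ge0.
move=> v vf; exists v; split.
  apply: filterS vf => x ->; rewrite /f.
  by case: ltP => // _; rewrite normc_e.
apply: L2dist_le_cst; first by rewrite addr_ge0// ltW.
apply: filterS vf => x ->; rewrite /f; case: ltP => [lt_e|_].
  by rewrite (le_trans (le_normcD _ _))// normcN normc_e lerD2r ltW.
by rewrite subrr ComplexField.Normc.normc0 addr_ge0// ltW.
Qed.

(** Since s^2 = 1, |e^(i t x) - s|^2 = 2 (1 - s cos(t x)), and the factor |z|^2
    is bounded below by c^2. *)
Lemma L2dist_phase_ge (c s t : R) (z v : L2 mu) : s ^+ 2 = 1 ->
  {ae mu, forall x, c <= normc (z x)} -> 0 <= c ->
  {ae mu, forall x, v x = s%:C%C * z x} ->
  2 * c ^+ 2 * (1 - s * \int[mu]_x cos (t * x)) <=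
  L2dist (linear_flow t z) v ^+ 2.
Proof.
move=> s2 c_le c_ge0 vE; rewrite -lee_fin L2dist_sqr.
pose k := 2 * c ^+ 2; pose f x := k - k * s * cos (t * x).
have icos := integrable_cos mu t.
have ik := finite_measure_integrable_cst mu k measurableT.
have iscos : mu.-integrable setT (EFin \o (fun x => k * s * cos (t * x))).
  by apply: (eq_integrable measurableT) (integrableZl measurableT (k * s) icos).
have int_f : mu.-integrable setT (EFin \o f).
  by apply: (eq_integrable measurableT) (integrableB measurableT ik iscos).
have -> : (2 * c ^+ 2 * (1 - s * \int[mu]_x cos (t * x)))%:E =
    (\int[mu]_x (f x)%:E)%E.
  rewrite -[RHS]fineK ?integrable_fin_num//; congr EFin.
  rewrite -/(Rintegral mu setT f) /f RintegralB// RintegralZl// Rintegral_cst//.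
  by rewrite [X in fine X]probability_setT /= mulr1 -/k; ring.
have s_cos_le1 x : s * cos (t * x) <= 1.
  have := sqr_ge0 (s - cos (t * x)); have := sqr_ge0 (sin (t * x)).
  by have := cos2Dsin2 (t * x); nra.
have fE x : f x = 2 * (1 - s * cos (t * x)) * c ^+ 2.
  by rewrite /f /k; ring.
apply: ae_ge0_le_integral => //.
- move=> x _; rewrite lee_fin fE.
  by rewrite mulr_ge0 ?sqr_ge0// mulr_ge0// subr_ge0.
- exact: measurable_int int_f.
- by move=> x _; rewrite lee_fin sqr_ge0.
- exact: measurable_sqr_normcB.
apply: filterS3 c_le vE (linear_flowE t z) => x c_le_x -> -> _.
rewrite -mulrBl ComplexField.Normc.normcM exprMn lee_fin fE.
have -> : normc (phase t x - s%:C%C) ^+ 2 = 2 * (1 - s * cos (t * x)).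
  rewrite sqr_normc /phase /= subr0.
  have := cos2Dsin2 (t * x); nra.
rewrite ler_wpM2l ?mulr_ge0 ?subr_ge0//.
by rewrite ler_sqr ?nnegrE ?normc_ge0.
Qed.
End L2_facts.

(** * Functions bounded away from zero *)

Section bounded_away.
Context (R : realType) (eta : R) (mu : probability R R).
Hypotheses (eta_gt0 : 0 < eta) (eta_lt1 : eta < 1).
Hypothesis mu_eta : is_bernoulli_measure eta mu.
Local Notation normc := ComplexField.Normc.normc.

Definition bounded_away (u : L2 mu) : Prop :=
  exists2 c : R, 0 < c & {ae mu, forall x, c <= normc (u x)}.

Lemma dense_bounded_away : dense bounded_away.
Proof.
move=> O [u Ou] openO.
have /nbhs_ballP[e /= e_gt0 ballO] : nbhs u O by exact: open_nbhs_nbhs.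
(* The truncation moves u by at most e / 4 + e / 4 < e. *)
have e4_gt0 : 0 < e / 4 by rewrite divr_gt0.
have [v [le_v uv]] := exists_L2_bounded_away u e4_gt0.
exists v; split; last by exists (e / 4).
by apply: ballO; rewrite /ball /=; apply: le_lt_trans uv _; lra.
Qed.

Lemma bounded_away_torus (u z : L2 mu) :
  invariant_torus u z -> bounded_away u -> bounded_away z.
Proof.
move=> uz [c c_gt0 c_le]; exists c => //.
by apply: filterS2 uz c_le => x /eq_norm_normc ->.
Qed.

(** The quantitative core of both conclusions: one radius r separates Phi_t z
    from z for t large, and from -z for all t. *)
Lemma flow_separation (z : L2 mu) : bounded_away z ->
  exists2 r : R, 0 < r &
    (forall t, pi / 2 < `|t| * eta -> r <= L2dist (linear_flow t z) z) /\
    (forall t (v : L2 mu), {ae mu, forall x, v x = - z x} ->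
      r <= L2dist (linear_flow t z) v).
Proof.
move=> [c c_gt0 c_le].
have /andP[_ kappa_lt1] := cos_scale_lt1 eta_gt0 eta_lt1.
set kappa := cos (eta * (pi / 2)) in kappa_lt1.
have gap_gt0 : 0 < 2 * c ^+ 2 * (1 - kappa).
  by rewrite !mulr_gt0 ?exprn_gt0 ?subr_gt0.
have sep s t (v : L2 mu) : s ^+ 2 = 1 ->
    {ae mu, forall x, v x = s%:C%C * z x} ->
    s * \int[mu]_x cos (t * x) <= kappa ->
    Num.sqrt (2 * c ^+ 2 * (1 - kappa)) <= L2dist (linear_flow t z) v.
  move=> s2 vE le_kappa.
  rewrite -ler_sqr ?nnegrE ?sqrtr_ge0 ?L2dist_ge0// sqr_sqrtr ?(ltW gap_gt0)//.
  apply: le_trans (L2dist_phase_ge t s2 c_le (ltW c_gt0) vE).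
  by rewrite ler_wpM2l ?mulr_ge0 ?(ltW c_gt0)// lerD2l lerN2.
exists (Num.sqrt (2 * c ^+ 2 * (1 - kappa))); first by rewrite sqrtr_gt0.
split=> [t t_big|t v vE].
  apply: (sep 1); first by rewrite expr1n.
    by apply: filterE => x; rewrite mul1r.
  rewrite mul1r; apply: le_trans (ler_norm _) _.
  exact: (bernoulli_cos_abs eta_gt0 eta_lt1 mu_eta).
apply: (sep (-1)); first by rewrite sqrrN expr1n.
  by apply: filterS vE => x ->; rewrite rmorphN mulN1r.
by rewrite mulN1r lerNl; exact: (bernoulli_cos_ge eta_gt0 eta_lt1 mu_eta).
Qed.

Lemma bounded_away_wandering (z : L2 mu) : bounded_away z -> wandering z.
Proof.
move=> /flow_separation[r r_gt0 [sep _]].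
exists (ball z (r / 2)); split; first by apply: nbhsx_ballx; rewrite divr_gt0.
exists (pi / 2 / eta); split; first by rewrite !divr_gt0 ?pi_gt0.
move=> t t_big; apply/seteqP; split=> // _ [[v zv <-] zflow].
have /sep : pi / 2 < `|t| * eta.
  by rewrite -ltr_pdivrMr//; exact: lt_le_trans t_big (ler_norm _).
rewrite leNgt => /negP; apply.
(* Were v and Phi_t v both within r / 2 of z, then Phi_t z would be within r
   of z, as Phi_t does not increase the distance of z to v. *)
apply: le_lt_trans (L2dist_triangle (linear_flow t v) _ _) _.
rewrite [ltRHS]splitr ltrD//.
  exact: le_lt_trans (linear_flow_contract _ _ _) zv.
by rewrite L2dist_sym.
Qed.

Lemma bounded_away_not_dense (u z : L2 mu) : bounded_away z ->
  invariant_torus u z -> ~ dense_in (trajectory z) (invariant_torus u).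
Proof.
move=> /flow_separation[r r_gt0 [_ sep]] uz dense_z.
have [v vE] := exists_L2_opp z.
have /dense_z v_closure : invariant_torus u v.
  by apply: filterS2 uz vE => x <- ->; rewrite normrN.
have [_ [[t _ <-] vt]] := v_closure _ (nbhsx_ballx v r r_gt0).
have := sep t v vE; rewrite leNgt => /negP; apply.
by rewrite L2dist_sym.
Qed.

End bounded_away.

Theorem theorem4p1 (R : realType) (eta : R) (mu : probability R R)
    (eta_gt0 : 0 < eta) (eta_lt1 : eta < 1)
    (mu_eta : is_bernoulli_measure eta mu) :
  exists2 D : set (L2 mu), dense D &
    forall u : L2 mu, D u ->
      (forall z, invariant_torus u z -> wandering z) /\
      (forall z, invariant_torus u z ->
        ~ dense_in (trajectory z) (invariant_torus u)).
Proof.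
exists (@bounded_away R mu); first exact: dense_bounded_away.
move=> u u_away; split=> z uz.
  apply: (bounded_away_wandering eta_gt0 eta_lt1 mu_eta).
  exact: bounded_away_torus uz u_away.
apply: (bounded_away_not_dense eta_gt0 eta_lt1 mu_eta) => //.
exact: bounded_away_torus uz u_away.
Qed.
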